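(* For every $n\ge 4$, the cycle graph $C_n$ satisfies $\operatorname{nim}(\mathrm{DNT}(C_n))=0$.
   Context: $C_n$ is the cycle graph with vertices $v_1,\dots,v_n$, where $v_i$ is adjacent to $v_{i+1}$ (indices modulo $n$). For a graph $G$ with vertex set $V$, a set $K\subseteq V$ is convex if it contains every vertex lying on any shortest path between two elements of $K$. The convex hull $[P]$ of $P\subseteq V$ is the smallest convex set containing $P$. The game $\mathrm{DNT}(G)$: positions are the sets $P\subseteq V$ with $[V\setminus P]=V$; the starting position is $\emptyset$; the options of $P$ are the sets $P\cup\{v\}$ with $v\in V\setminus P$ and $[V\setminus(P\cup\{v\})]=V$. The nim-value of a position is defined recursively by $\operatorname{nim}(p)=\operatorname{mex}\{\operatorname{nim}(q): q\text{ an option of }p\}$, where $\operatorname{mex}(A)$ is the smallest nonnegative integer not in $A$; the nim-value of a game is that of its starting position. *)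

(* Defs.v *)
From mathcomp Require Import all_boot.

Set Implicit Arguments.
Unset Strict Implicit.
Unset Printing Implicit Defensive.

Section GeodesicConvexity.

Variables (T : finType) (e : rel T).

Definition walk (n : nat) (x y : T) : bool :=
  [exists p : n.-tuple T, path e x p && (last x p == y)].

(* [x :: p] is a shortest path from [x] to [last x p]; its length is [size p]. *)
Definition shortest_path (x : T) (p : seq T) : bool :=
  path e x p && [forall m : 'I_(size p), ~~ walk m x (last x p)].

(* A shortest path has no repeated vertex, hence fewer than #|T| edges: the
   bound on [n] only makes the quantification finite, cf. [convexP]. *)
Definition convex (K : {set T}) : bool :=
  [forall x in K, forall y in K, forall n : 'I_#|T|, forall p : n.-tuple T,
     shortest_path x p && (last x p == y) ==> all [in K] p].

Definition hull (P : {set T}) : {set T} :=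
  \bigcap_(K : {set T} | convex K && (P \subset K)) K.

Lemma shortest_pathP (x : T) (p : seq T) :
  reflect (path e x p /\
           forall q, path e x q -> last x q = last x p -> size p <= size q)
          (shortest_path x p).
Proof.
apply: (iffP andP) => [[xp /forallP min_p]|[xp min_p]]; split=> //.
  move=> q xq eq_pq; rewrite leqNgt; apply/negP => lt_qp.
  move/negP: (min_p (Ordinal lt_qp)); apply; apply/existsP.
  by exists (in_tuple q); rewrite xq eq_pq eqxx.
apply/forallP => m; apply/existsP => -[q /andP[xq /eqP eq_pq]].
by have := min_p _ xq eq_pq; rewrite size_tuple leqNgt ltn_ord.
Qed.

Lemma shortest_path_size (x : T) (p : seq T) :
  shortest_path x p -> size p < #|T|.
Proof.
case/shortest_pathP => xp min_p.
have [q [xq uq eq_last]] : exists q,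
    [/\ path e x q, uniq (x :: q) & last x q = last x p].
  by case: (shortenP xp) => q xq uq _; exists q.
apply: (leq_ltn_trans (min_p q xq eq_last)).
by have := max_card (mem (x :: q)); rewrite (card_uniqP uq).
Qed.

Lemma convexP (K : {set T}) :
  reflect (forall x p, x \in K -> last x p \in K -> shortest_path x p ->
             {subset p <= K})
          (convex K).
Proof.
apply: (iffP forall_inP) => [cK x p xK yK sp|cK x xK].
  have /forall_inP/(_ _ yK)/forallP/(_ (Ordinal (shortest_path_size sp))) :=
    cK x xK.
  by move=> /forallP/(_ (in_tuple p)) /=; rewrite sp eqxx => /allP.
apply/forall_inP => y yK; apply/forallP => n; apply/forallP => p.
by apply/implyP => /andP[sp /eqP ey]; apply/allP/(cK x); rewrite ?ey.
Qed.

Lemma sub_hull (P : {set T}) : P \subset hull P.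
Proof. by apply/bigcapsP => K /andP[]. Qed.

Lemma hull_min (P K : {set T}) : convex K -> P \subset K -> hull P \subset K.
Proof. by move=> cK sPK; apply: bigcap_inf; rewrite cK. Qed.

Lemma convex_hull (P : {set T}) : convex (hull P).
Proof.
apply/convexP => x p /bigcapP xP /bigcapP yP sp z zp.
apply/bigcapP => K hK; have /andP[/convexP cK _] := hK.
exact: cK (xP K hK) (yP K hK) sp z zp.
Qed.

End GeodesicConvexity.

Lemma mex_subproof (s : seq nat) : exists m, m \notin s.
Proof.
exists (sumn s).+1; apply/negP => /= ins.
suff: (sumn s).+1 <= sumn s by rewrite ltnn.
by rewrite {2}sumnE (big_rem _ ins) /= leq_addr.
Qed.

Definition mex (s : seq nat) : nat := ex_minn (mex_subproof s).

Section DoNotTerminate.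

Variables (T : finType) (e : rel T).

Definition dnt_position (P : {set T}) : bool := hull e (~: P) == [set: T].

Definition dnt_options (P : {set T}) : {set {set T}} :=
  [set v |: P | v in ~: P & dnt_position (v |: P)].

(* [k] bounds the number of remaining moves. *)
Fixpoint dnt_nim_rec (k : nat) (P : {set T}) : nat :=
  if k is k'.+1 then mex [seq dnt_nim_rec k' Q | Q in dnt_options P] else 0.

Definition dnt_nim (P : {set T}) : nat := dnt_nim_rec #|~: P|.+1 P.

Definition nim_DNT : nat := dnt_nim set0.

Lemma dnt_option_card (P Q : {set T}) :
  Q \in dnt_options P -> #|~: P| = #|~: Q|.+1.
Proof.
case/imsetP => v; rewrite inE => /andP[vP _] ->.
by rewrite setCU setIC -setDE (cardsD1 v (~: P)) vP.
Qed.

Lemma dnt_nimE (P : {set T}) :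
  dnt_nim P = mex [seq dnt_nim Q | Q in dnt_options P].
Proof.
rewrite {1}/dnt_nim /=; congr mex; apply/eq_in_map => Q.
by rewrite mem_enum => /dnt_option_card ->.
Qed.

End DoNotTerminate.

(* The vertex v_(i+1) is the ordinal i; [ordS] is the successor modulo n. *)
Definition cycle_graph (n : nat) : rel 'I_n :=
  fun i j => (j == ordS i) || (i == ordS j).

(* Main.v *)
Require Import Defs.
From mathcomp Require Import all_boot.
From mathcomp Require Import zify.

Set Implicit Arguments.
Unset Strict Implicit.
Unset Printing Implicit Defensive.

(* A set of vertices of C_n generates C_n iff it is not contained in an arc
   shorter than n/2, so the game consists in selecting vertices without ever
   selecting k = n./2 consecutive ones; we show that the second player wins.
   If n = 2k, he answers v by its antipode: a k-arc contains exactly one vertex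
   of each antipodal pair, so a k-arc completed by this answer would have an
   antipodal k-arc completed by the move v itself.
   If n = 2k + 1, the game always ends with exactly three unselected vertices,
   and n - 3 is even.  Indeed, if each unselected v lies in a k-arc I_v whose
   other vertices are all selected, then the unselected vertices other than v
   lie in a (k+1)-arc; if there were three of them x, y, z in this order, I_y
   would lie strictly between x and z, which leaves room for k - 1 vertices
   only. *)

(** * Games of nim-value zero *)

Lemma mex_eq0 (s : seq nat) : (mex s == 0) = (0 \notin s).
Proof.
rewrite /mex; case: ex_minnP => m ms min_m.
apply/eqP/idP => [<- //|/min_m]; by rewrite leqn0 => /eqP.
Qed.

(** [W] is an invariant that the second player restores. By induction on the number of unselected
    vertices, each option of [P] has an option of value 0, hence a nonzero value itself. *)
Lemma dnt_nim_eq0 (T : finType) (e : rel T) (W : {set T} -> Prop) :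
    (forall P Q, W P -> Q \in dnt_options e P ->
       exists2 R, R \in dnt_options e Q & W R) ->
  forall P, W P -> dnt_nim e P = 0.
Proof.
move=> answer P; have [m] := ubnP #|~: P|.
elim: m P => // m IHm P ltPm WP.
apply/eqP; rewrite dnt_nimE mex_eq0; apply/imageP => -[Q QP] /esym/eqP.
rewrite dnt_nimE mex_eq0 => /negP; apply.
have [R RQ WR] := answer P Q WP QP.
apply/imageP; exists R => //; rewrite IHm //.
by have := dnt_option_card QP; have := dnt_option_card RQ; lia.
Qed.

(* [lia] treats an [if] as an atom; innermost conditions must be split first. *)
Ltac lia_if :=
  repeat match goal with
    | |- context [if ?b then _ else _] =>
        lazymatch b with
        | context [if _ then _ else _] => fail
        | _ => case: (boolP b) => ?
        end
    end; lia.

(** * Arcs and distances in the cycle *)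

Section Cycle.

Variable n : nat.
Implicit Types (a x y z u v : 'I_n) (P K : {set 'I_n}).

Local Notation e := (@cycle_graph n).

(** The residue of [y - x] modulo [n], in a form that [lia] can treat. For [k <= n], the condition
    [fwd a u < k] describes the arc of [k] vertices starting at [a]. *)
Definition fwd x y : nat := if x <= y then y - x else y + n - x.

(** The graph distance: [cdist_walk] attains it and [cdist_path] bounds walks from below. *)
Definition cdist x y : nat := minn (fwd x y) (fwd y x).

Lemma fwd_lt x y : fwd x y < n.
Proof. by have := ltn_ord x; have := ltn_ord y; rewrite /fwd; case: (leqP x y); lia. Qed.

Lemma fwdxx x : fwd x x = 0.
Proof. by rewrite /fwd leqnn subnn. Qed.

Lemma fwd_inj a : injective (fwd a).
Proof.
move=> x y eq_xy; apply/val_inj; move: eq_xy => /=; rewrite /fwd.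
by have := ltn_ord x; have := ltn_ord y; have := ltn_ord a; lia_if.
Qed.

(** Reads all positions from one base point, which turns statements about arcs into linear
    arithmetic. *)
Lemma fwd_base a x y :
  fwd x y = if fwd a x <= fwd a y then fwd a y - fwd a x
            else fwd a y + n - fwd a x.
Proof.
have := ltn_ord x; have := ltn_ord y; have := ltn_ord a.
by rewrite /fwd; lia_if.
Qed.

Lemma val_ordS x : ordS x = (if x.+1 == n then 0 else x.+1) :> nat.
Proof.
rewrite /=; case: eqP => [->|/eqP neq]; first by rewrite modnn.
by rewrite modn_small // ltn_neqAle neq ltn_ord.
Qed.

Lemma fwd_ordS a x :
  fwd a (ordS x) = if (fwd a x).+1 == n then 0 else (fwd a x).+1.
Proof.
have := val_ordS x; have := ltn_ord x; have := ltn_ord a.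
by rewrite /fwd; lia_if.
Qed.

Lemma fwd_iter a i : i < n -> fwd a (iter i (@ordS n) a) = i.
Proof.
elim: i => [|i IHi] lt_in; first exact: fwdxx.
by rewrite iterS fwd_ordS IHi 1?ltnW // ltn_eqF.
Qed.

Lemma iter_fwd a x : iter (fwd a x) (@ordS n) a = x.
Proof. by apply: (@fwd_inj a); rewrite fwd_iter ?fwd_lt. Qed.

Lemma iter_ordS_n a : iter n (@ordS n) a = a.
Proof.
have n_gt0 : 0 < n by apply: leq_ltn_trans (ltn_ord a).
apply: (@fwd_inj a); have -> : iter n (@ordS n) a = ordS (iter n.-1 (@ordS n) a).
  by rewrite -iterS prednK.
by rewrite fwd_ordS fwd_iter prednK // eqxx fwdxx.
Qed.

Lemma cycle_graph_sym : symmetric e.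
Proof. by move=> x y; rewrite /cycle_graph orbC. Qed.

Lemma path_traject_ordS x m : path e x (traject (@ordS n) (ordS x) m).
Proof.
apply: (@sub_path _ (frel (@ordS n))); last exact: fpath_traject.
by move=> y z /eqP <-; rewrite /cycle_graph eqxx.
Qed.

Lemma cdist_walk x y :
  exists p, [/\ path e x p, last x p = y & size p = cdist x y].
Proof.
suff fwd_walk u v : exists p, [/\ path e u p, last u p = v & size p = fwd u v].
  rewrite /cdist; case: (leqP (fwd x y) (fwd y x)) => _; first exact: fwd_walk.
  have [p [yp lastp sizep]] := fwd_walk y x.
  exists (rev (belast y p)); split; last by rewrite size_rev size_belast.
    rewrite -lastp rev_path; apply: sub_path yp => u v.
    by rewrite cycle_graph_sym.
  by rewrite -lastp; case: p {yp lastp sizep} => //= z p; rewrite rev_cons last_rcons.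
exists (traject (@ordS n) (ordS u) (fwd u v)).
by rewrite path_traject_ordS last_traject iter_fwd size_traject.
Qed.

Lemma cdist_edge x y z : e x y -> cdist x z <= (cdist y z).+1.
Proof.
have := ltn_ord x; have := ltn_ord y; have := ltn_ord z.
rewrite /cycle_graph /cdist /fwd => ? ? ? /orP[] /eqP/(congr1 val)/=.
  by have /= -> := val_ordS x; lia_if.
by have /= -> := val_ordS y; lia_if.
Qed.

Lemma cdist_path x p : path e x p -> cdist x (last x p) <= size p.
Proof.
elim: p x => [|y p IHp] x /=; first by rewrite /cdist fwdxx.
by case/andP=> /(cdist_edge (last y p)) le_xy /IHp; lia.
Qed.

(** * Convex sets and generating sets of the cycle *)

(** The complement of a [k]-arc has at most [k + 1] vertices. Two of them are at most [k] steps
    apart within it, but at least [k + 1] steps apart through the arc. *)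
Lemma convex_coarc a k : n <= k.*2.+1 -> convex e [set u | k <= fwd a u].
Proof.
move=> le_nk; apply/convexP => x p; rewrite !inE => kx ky.
case/shortest_pathP => xp min_p z zp; rewrite inE leqNgt; apply/negP => zk.
have [q [xq lastq sizeq]] := cdist_walk x (last x p).
have := min_p q xq lastq; rewrite {}sizeq {min_p q xq lastq}.
case/splitPr: zp xp ky => p1 p2.
rewrite cat_path last_cat size_cat /= => /and3P[xp1 e1 zp2] ky.
have := cdist_path (x := x) (p := rcons p1 z).
rewrite rcons_path xp1 e1 last_rcons size_rcons => /(_ isT).
have := cdist_path zp2.
rewrite /cdist !(fwd_base a x) !(fwd_base a (last z p2)) !(fwd_base a z).
have := fwd_lt a x; have := fwd_lt a (last z p2).
move: (fwd a (last z p2)) (fwd a x) (fwd a z) (size p1) (size p2) kx ky zk => j i t s1 s2.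
by lia_if.
Qed.

Lemma shortest_traject_ordS x m :
  m <= n./2 -> shortest_path e x (traject (@ordS n) (ordS x) m).
Proof.
move=> le_m; apply/shortest_pathP; split=> [|q xq lastq].
  exact: path_traject_ordS.
apply: leq_trans (cdist_path xq); rewrite lastq last_traject size_traject.
have n_gt0 : 0 < n by apply: leq_ltn_trans (ltn_ord x).
have lt_mn : m < n by lia.
by rewrite /cdist (fwd_base x _ x) fwdxx fwd_iter //; lia_if.
Qed.

(** Leave [K] at [w] and walk forward until the first return. A return within [n./2] steps would be
    a shortest path, and convexity would put [ordS w] in [K]. *)
Lemma proper_convex_gap K : 0 < n -> convex e K -> K != setT ->
  exists a, forall u, fwd a u < n./2 -> u \notin K.
Proof.
move=> n_gt0 /convexP cK nKT.
have [K0|[w0 w0K]] := set_0Vmem K.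
  by exists (Ordinal n_gt0) => u _; rewrite K0 inE.
(* If [K] were closed under [ordS], it would contain the whole orbit of [w0], which is every
   vertex. *)
have [w wK SwK] : exists2 w, w \in K & ordS w \notin K.
  case: (pickP [pred w | (w \in K) && (ordS w \notin K)]) => [w /andP[]|closedK].
    by exists w.
  case/eqP: nKT; apply/setP => v; rewrite inE -(iter_fwd w0 v).
  elim: (fwd w0 v) => //= i IHi.
  by have := closedK (iter i (@ordS n) w0); rewrite /= IHi => /negbFE.
have ex_s : exists s, (0 < s) && (iter s (@ordS n) w \in K).
  by exists n; rewrite n_gt0 iter_ordS_n.
case: (ex_minnP ex_s) => s /andP[s_gt0 sK] min_s.
have lt_ks : n./2 < s.
  rewrite ltnNge; apply/negP => le_sk.
  have := cK w _ wK _ (shortest_traject_ordS w le_sk).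
  rewrite last_traject => /(_ sK (ordS w)) SwK'; case/negP: SwK; apply: SwK'.
  by rewrite -(prednK s_gt0) trajectS mem_head.
exists (ordS w) => u lt_u; apply/negP => uK.
have := min_s (fwd (ordS w) u).+1.
by rewrite iterSr iter_fwd uK => /(_ isT); lia.
Qed.

(** If [P] contains an arc of [n./2] vertices, its complement lies in a proper convex set by
    [convex_coarc], as [n <= 2 * n./2 + 1]. Conversely, a proper hull misses such an arc. *)
Lemma dnt_positionP P : 1 < n ->
  reflect (forall a, exists2 u, fwd a u < n./2 & u \notin P)
          (dnt_position e P).
Proof.
move=> n_gt1; have n_gt0 := ltnW n_gt1.
apply: (iffP eqP) => [hullT a|noarc].
  apply/exists_inP; apply: contraT; rewrite negb_exists_in => /forall_inP arcP.
  suff /subsetP/(_ a) : [set: 'I_n] \subset [set u | n./2 <= fwd a u].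
    by rewrite !inE fwdxx => /(_ isT); lia.
  rewrite -hullT; apply: hull_min; first by apply: convex_coarc; lia.
  apply/subsetP => u; rewrite !inE leqNgt; apply: contra => /arcP.
  by rewrite negbK.
apply/eqP; apply: contraT => /(proper_convex_gap n_gt0 (convex_hull _ _))[a gap].
have [u /gap uK uP] := noarc a; case/negP: uK.
by apply: (subsetP (sub_hull _ _)); rewrite inE.
Qed.

Lemma dnt_option_setU1 P v :
  v \notin P -> dnt_position e (v |: P) -> v |: P \in dnt_options e P.
Proof. by move=> vP posP; apply/imsetP; exists v; rewrite ?inE ?vP. Qed.

Lemma dnt_option_position P Q : Q \in dnt_options e P -> dnt_position e Q.
Proof. by case/imsetP=> v; rewrite inE => /andP[_ ?] ->. Qed.

(** * Even cycles: the antipodal answer *)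

Definition antipode x : 'I_n := iter n./2 (@ordS n) x.

Lemma fwd_antipode a x : 1 < n ->
  fwd a (antipode x) =
    if fwd a x + n./2 < n then fwd a x + n./2 else fwd a x + n./2 - n.
Proof.
move=> n_gt1; have := fwd_lt a x; have := fwd_lt a (antipode x).
have := fwd_base a x (antipode x); rewrite fwd_iter; lia_if.
Qed.

Lemma antipodeK : 1 < n -> ~~ odd n -> involutive antipode.
Proof.
move=> n_gt1 n_even x; apply: (@fwd_inj x).
by rewrite !fwd_antipode // fwdxx; lia_if.
Qed.

Lemma dnt_answer_even P Q : 1 < n -> ~~ odd n ->
    {homo antipode : x / x \in P} -> Q \in dnt_options e P ->
  exists2 R, R \in dnt_options e Q & {homo antipode : x / x \in R}.
Proof.
move=> n_gt1 n_even symP /imsetP[v]; rewrite 2!inE => /andP[vP posQ] ->{Q}.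
have aK := antipodeK n_gt1 n_even.
have av_neq : antipode v != v.
  by apply/eqP => /(congr1 (fwd v)); rewrite fwd_antipode // fwdxx; lia_if.
exists (antipode v |: (v |: P)); last first.
  move=> x; rewrite !inE (can_eq aK) (can2_eq aK aK) => /or3P[->|->|/symP ->];
    by rewrite ?orbT.
apply: dnt_option_setU1.
  rewrite !inE (negPf av_neq) /=; apply: contra vP => /symP; by rewrite aK.
apply/dnt_positionP => // a.
have [u ua uQ] := dnt_positionP _ n_gt1 posQ a.
have [u_av|u_av] := eqVneq u (antipode v); last first.
  by exists u => //; rewrite in_setU1 negb_or u_av.
(* The answer uses up the witness [u] of the arc at [a]. An unselected [w] in the antipodal arc
   provides the new witness [antipode w]. *)
have [w wa] := dnt_positionP _ n_gt1 posQ (antipode a).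
rewrite in_setU1 negb_or => /andP[w_v wP].
have {}ua : fwd a (antipode v) < n./2 by rewrite -u_av.
have {}wa : fwd a (antipode w) < n./2.
  move: wa; rewrite (fwd_base a (antipode a) w) !fwd_antipode // fwdxx.
  by have := fwd_lt a w; lia_if.
exists (antipode w) => //; rewrite !inE (can_eq aK) (negPf w_v) /=.
rewrite negb_or; apply/andP; split.
  (* Otherwise the arc of [n./2] vertices at [a] would contain both [v] and its antipode. *)
  apply/eqP => wv; move: ua wa; rewrite wv fwd_antipode //.
  by have := fwd_lt a v; lia_if.
by apply: contra wP => /symP; rewrite aK.
Qed.

(** * Odd cycles: three vertices remain unselected *)

Lemma card_blocked_position P : 1 < n -> odd n ->
    (forall v, v \notin P -> ~~ dnt_position e (v |: P)) ->
  dnt_position e P -> #|~: P| <= 3.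
Proof.
move=> n_gt1 n_odd blocked posP.
(* Selecting [v] completes an arc that [P] does not contain, so [v] is the only unselected vertex of
   that arc. *)
have private v : v \notin P ->
    exists2 b, fwd b v < n./2 &
      forall u, fwd b u < n./2 -> u \notin P -> u = v.
  move=> vP.
  have [b /forall_inP arcb] : exists b, [forall (u | fwd b u < n./2), u \in v |: P].
    apply/existsP; apply: contraR (blocked v vP) => /existsPn noarc.
    apply/dnt_positionP => // a.
    by have /forall_inPn[u ? ?] := noarc a; exists u.
  exists b => [|u ub uP]; last first.
    by move: (arcb u ub); rewrite in_setU1 (negPf uP) orbF => /eqP.
  have [u ub uP] := dnt_positionP _ n_gt1 posP b.
  by move: (arcb u ub); rewrite in_setU1 (negPf uP) orbF => /eqP <-.
rewrite leqNgt; apply/negP => card4.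
have [v vP] : exists v, v \in ~: P.
  by apply/set0Pn; rewrite -card_gt0; apply: leq_trans card4.
have [b bv arcb] : exists2 b, fwd b v < n./2 &
  forall u, fwd b u < n./2 -> u \notin P -> u = v.
  by apply: private; rewrite inE in vP.
(* The private arc of [y] avoids [x] and [z], so it lies strictly between them. Read from [b], these
   have positions between [n./2] and [2 * n./2], which leaves room for [n./2 - 1] vertices. *)
have no_middle x y z : x \notin P -> y \notin P -> z \notin P ->
    n./2 <= fwd b x -> fwd b x < fwd b y -> fwd b y < fwd b z -> False.
  move=> xP yP zP bx xy yz; have [c cy arcc] := private y yP.
  have cx : n./2 <= fwd c x.
    by rewrite leqNgt; apply/negP => /arcc/(_ xP) eq_xy; rewrite eq_xy ltnn in xy.
  have cz : n./2 <= fwd c z.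
    by rewrite leqNgt; apply/negP => /arcc/(_ zP) eq_zy; rewrite eq_zy ltnn in yz.
  have := fwd_lt b z; have := fwd_lt b c.
  move: cx cy cz; rewrite !(fwd_base b c); lia_if.
have : 2 < #|~: P :\ v| by move: card4; rewrite (cardsD1 v) vP.
case/card_gt2P => x [y [z []]] [xP yP zP] [xy yz zx].
have far u : u \in ~: P :\ v -> u \notin P /\ n./2 <= fwd b u.
  rewrite !inE => /andP[uv uP]; split=> //; rewrite leqNgt.
  by apply: contra uv => /arcb/(_ uP)/eqP.
have [{}xP bx] := far x xP; have [{}yP by_] := far y yP.
have [{}zP bz] := far z zP.
move: xy yz zx; rewrite -!(inj_eq (@fwd_inj b)).
(* Of the eight sign patterns the two cyclic ones are contradictory; each of the other six orders
   has a middle vertex. *)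
case: (ltngtP (fwd b x) (fwd b y)) => // xy _;
  case: (ltngtP (fwd b y) (fwd b z)) => // yz _;
  case: (ltngtP (fwd b z) (fwd b x)) => // zx _; try lia.
all: by [apply: (no_middle x y z)|apply: (no_middle y z x)|
  apply: (no_middle z x y)|apply: (no_middle x z y)|
  apply: (no_middle z y x)|apply: (no_middle y x z)].
Qed.

(** Two unselected vertices separate the other [2 * n./2 - 1] into two gaps, one of which has at
    least [n./2] vertices, all selected. *)
Lemma card_dnt_position P : 1 < n -> odd n ->
  dnt_position e P -> 2 < #|~: P|.
Proof.
move=> n_gt1 n_odd posP; rewrite ltnNge; apply/negP => card2.
have [u _ uP] := dnt_positionP _ n_gt1 posP (Ordinal (ltnW n_gt1)).
have [x subP] : exists x, forall w, w \notin P -> w = u \/ w = x.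
  have : #|~: P :\ u| <= 1 by move: card2; rewrite (cardsD1 u) inE uP.
  case: (set_0Vmem (~: P :\ u)) => [P0 _|[x xP] /card_le1_eqP card1P].
    (* When [u] is the only unselected vertex, [x] is taken to be [u] too. *)
    exists u => w wP; left; apply/eqP; apply: contraT => wu.
    by have := in_set0 w; rewrite -P0 !inE wP wu.
  exists x => w wP; have [->|wu] := eqVneq w u; [by left|right].
  by apply: card1P => //; rewrite !inE wu.
(* The two forward distances between distinct [u] and [x] add up to [2 * n./2 + 1], so one of them
   is at most [n./2]. *)
wlog le_k : u x {uP} subP / fwd u x <= n./2.
  move=> wl; case: (leqP (fwd u x) n./2) => [|lt_k]; first exact: wl subP.
  apply: (wl x u) => [w /subP[]|]; [by right|by left|].
  by rewrite (fwd_base u x u) fwdxx; have := fwd_lt u x; lia_if.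
(* The [n./2] vertices preceding [u] are all selected. *)
have [w] := dnt_positionP _ n_gt1 posP (iter n./2.+1 (@ordS n) u).
rewrite (fwd_base u) fwd_iter; last by lia.
by move=> + /subP[] => /[swap] ->; rewrite ?fwdxx; lia_if.
Qed.

(** Any available move is a good answer. One exists because the number of unselected vertices of [Q]
    is even and exceeds 2, hence exceeds 3, so [Q] is not blocked. *)
Lemma dnt_answer_odd P Q : 1 < n -> odd n ->
    odd #|~: P| -> Q \in dnt_options e P ->
  exists2 R, R \in dnt_options e Q & odd #|~: R|.
Proof.
move=> n_gt1 n_odd oddP QP; have posQ := dnt_option_position QP.
have oddQ : ~~ odd #|~: Q| by move: oddP; rewrite (dnt_option_card QP).
have [v] : exists v, (v \notin Q) && dnt_position e (v |: Q).
  apply/existsP; apply: contraT => /existsPn blocked.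
  have := card_dnt_position n_gt1 n_odd posQ.
  suff : #|~: Q| <= 3 by case: #|~: Q| oddQ => [|[|[|[]]]].
  apply: card_blocked_position => // v vQ.
  by have := blocked v; rewrite vQ.
case/andP=> vQ posR; have RQ := dnt_option_setU1 vQ posR.
by exists (v |: Q) => //; move: oddQ; rewrite (dnt_option_card RQ) negbK.
Qed.

End Cycle.

(** * The starting position satisfies the invariant for either parity of [n] *)

Theorem proposition5p3 (n : nat) (hn : 4 <= n) : nim_DNT (@cycle_graph n) = 0.
Proof.
have n_gt1 : 1 < n by apply: leq_trans hn.
case: (boolP (odd n)) => [n_odd|n_even].
  apply: (@dnt_nim_eq0 _ _ (fun P => odd #|~: P|)) => [P Q|].
    exact: dnt_answer_odd.
  by rewrite setC0 cardsT card_ord.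
apply: (@dnt_nim_eq0 _ _ (fun P => {homo @antipode n : x / x \in P})) => [P Q|x].
  exact: dnt_answer_even.
by rewrite inE.
Qed.
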